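(* Let $K$ be a commutative unital ring, $S$ an inverse monoid and $V$ a left $KS$-module. Define the $K$-modules $$C^0(S,V)=V,\qquad C^n(S,V)=\{f:S^n\to V\mid f(s_1,\dots,s_n)\in\mathbf r(s_1\cdots s_n)V\ \text{for all } s_1,\dots,s_n\in S\},\ n>0,$$ and the maps $\delta^n:C^n(S,V)\to C^{n+1}(S,V)$ by $$(\delta^0x)(s)=sx-\mathbf r(s)x,\quad x\in C^0(S,V),$$ $$(\delta^nf)(s_1,\dots,s_{n+1})=s_1f(s_2,\dots,s_{n+1})+\sum_{i=1}^n(-1)^if(s_1,\dots,s_is_{i+1},\dots,s_{n+1})+(-1)^{n+1}\mathbf r(s_1\cdots s_{n+1})f(s_1,\dots,s_n)$$ for $n>0$, $f\in C^n(S,V)$. Then the sequence $$0\to C^0(S,V)\xrightarrow{\delta^0}C^1(S,V)\xrightarrow{\delta^1}\cdots$$ is a cochain complex of $K$-modules whose $n$-th cohomology $K$-module is isomorphic to $H^n(S,V)$.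
   Context: $KS$ is the semigroup algebra of $S$ over $K$, $E(S)$ is the set (commutative submonoid) of idempotents of $S$, and $KE(S)$ is its semigroup algebra, regarded as a left $KS$-module by $s\cdot e=ses^{-1}$ for $s\in S$, $e\in E(S)$. For $s\in S$, $\mathbf r(s)=ss^{-1}$. For a left $KS$-module $V$ and $n\ge 0$, $H^n(S,V)=\operatorname{Ext}^n_{KS}(KE(S),V)$. *)

(* Defs.v *)
From HB Require Import structures.
From mathcomp Require Import all_boot all_algebra finmap.
From mathcomp Require Import boolp functions.
From mathcomp Require Import monalg.

Set Implicit Arguments.
Unset Strict Implicit.
Unset Printing Implicit Defensive.

Import GRing.Theory.
Local Open Scope ring_scope.
Local Open Scope quotient_scope.

(* An inverse monoid is a monoid in which every x has exactly one y such that
   x y x = x and y x y = y; this y is written x^-1.  Uniqueness forces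
   (x^-1)^-1 = x and (x y)^-1 = y^-1 x^-1, so the structure sits on top of
   starMonoidType; the factory isInverseMonoid below builds it from the bare
   definition. *)
HB.mixin Record StarMonoid_isInverseMonoid S of StarMonoid S := {
  mulgVg : forall x : S, (x * x^-1 * x = x)%g;
  invg_unique : forall x y : S,
    (x * y * x = x)%g -> (y * x * y = y)%g -> (y = x^-1)%g
}.

#[short(type="inverseMonoidType")]
HB.structure Definition InverseMonoid :=
  {S of StarMonoid_isInverseMonoid S & StarMonoid S}.

Section InverseOperation.
Variables (S : monoidType) (inv : S -> S).
Hypothesis mulxVx : forall x : S, (x * inv x * x = x)%g.
Hypothesis mulVxV : forall x : S, (inv x * x * inv x = inv x)%g.
Hypothesis inv_unique : forall x y : S,
  (x * y * x = x)%g -> (y * x * y = y)%g -> (y = inv x)%g.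
Implicit Types s t e f : S.
Local Open Scope group_scope.

Let idem e := e * e = e.

Fact inverse_invK s : inv (inv s) = s.
Proof. by symmetry; apply: inv_unique; rewrite ?mulVxV ?mulxVx. Qed.

Let idemV e : idem e -> inv e = e.
Proof. by move=> ee; symmetry; apply: inv_unique; rewrite !ee. Qed.

Let idemM e f : idem e -> idem f -> idem (e * f).
Proof.
move=> ee ff; set x := inv (e * f).
have ex : e * f * x * (e * f) = e * f by exact: mulxVx.
have xe : x * (e * f) * x = x by exact: mulVxV.
have fxe : f * x * e = x.
  apply: inv_unique.
    by rewrite -!mulgA (mulgA e e) ee (mulgA f f) ff !mulgA in ex *.
  rewrite -!mulgA (mulgA e e) ee (mulgA f f) ff.
  by congr (_ * _); rewrite !mulgA -(mulgA x e f) xe.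
have xx : idem x.
  rewrite /idem -{1 2}fxe !mulgA -(mulgA _ e f).
  by rewrite -(mulgA f) -(mulgA f) xe.
by rewrite -[e * f]inverse_invK -/x (idemV xx).
Qed.

Fact inverse_idemC e f : idem e -> idem f -> e * f = f * e.
Proof.
move=> ee ff; have h1 := idemM ee ff; have h2 := idemM ff ee.
have -> : f * e = inv (e * f).
  apply: inv_unique.
    by rewrite -!mulgA (mulgA f f) ff (mulgA e e) ee !mulgA; rewrite /idem !mulgA in h1.
  by rewrite -!mulgA (mulgA f f) (mulgA e e) ff ee !mulgA; rewrite /idem !mulgA in h2.
by rewrite idemV //; apply: idemM.
Qed.

Fact inverse_invM s t : inv (s * t) = inv t * inv s.
Proof.
have C : t * inv t * (inv s * s) = inv s * s * (t * inv t).
  by apply: inverse_idemC; rewrite /idem mulgA ?mulVxV ?mulxVx.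
symmetry; apply: inv_unique.
  transitivity (s * ((t * inv t) * (inv s * s)) * t); first by rewrite !mulgA.
  by rewrite C !mulgA mulxVx -!mulgA (mulgA t) mulxVx.
transitivity (inv t * ((inv s * s) * (t * inv t)) * inv s); first by rewrite !mulgA.
by rewrite -C !mulgA mulVxV -!mulgA (mulgA (inv s)) mulVxV.
Qed.
End InverseOperation.

HB.factory Record isInverseMonoid S of Monoid S := {
  inv : S -> S;
  mulxVx : forall x : S, (x * inv x * x = x)%g;
  mulVxV : forall x : S, (inv x * x * inv x = inv x)%g;
  inv_unique : forall x y : S,
    (x * y * x = x)%g -> (y * x * y = y)%g -> (y = inv x)%g
}.

HB.builders Context S of isInverseMonoid S.
HB.instance Definition _ := hasInv.Build S inv.
HB.instance Definition _ := Monoid_isStarMonoid.Build S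
  (inverse_invK mulxVx mulVxV inv_unique)
  (inverse_invM mulxVx mulVxV inv_unique).
HB.instance Definition _ :=
  StarMonoid_isInverseMonoid.Build S mulxVx inv_unique.
HB.end.

Section InverseMonoidTheory.
Variable S : inverseMonoidType.
Implicit Types s t e f : S.
Local Open Scope group_scope.

(* The range idempotent r(s). *)
Definition rs s : S := s * s^-1.

Definition idem : pred S := fun e => e * e == e.

Lemma mulVgV s : s^-1 * s * s^-1 = s^-1.
Proof. by have := mulgVg s^-1; rewrite invgK. Qed.

Lemma idemC e f : idem e -> idem f -> e * f = f * e.
Proof.
by move=> /eqP + /eqP; apply: inverse_idemC; [exact: mulgVg|exact: mulVgV|exact: invg_unique].
Qed.

Lemma idem_rs s : idem (s * s^-1).
Proof. by rewrite /idem mulgA mulgVg. Qed.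

Lemma idem_ds s : idem (s^-1 * s).
Proof. by rewrite /idem mulgA mulVgV. Qed.

Lemma idem_conj s e : idem e -> idem (s * e * s^-1).
Proof.
move=> ie; have C := idemC ie (idem_ds s); move: (ie) => /eqP ee.
apply/eqP; transitivity (s * (e * (s^-1 * s)) * e * s^-1); first by rewrite !mulgA.
by rewrite C !mulgA mulgVg -(mulgA s e e) ee.
Qed.

Lemma rs_mull s : rs s * s = s. Proof. exact: mulgVg. Qed.

Lemma rs_rs s : rs s * rs s = rs s. Proof. exact/eqP/idem_rs. Qed.

Lemma rs_mul s t : rs (s * t) * s = s * rs t.
Proof.
rewrite /rs invgM.
transitivity (s * ((t * t^-1) * (s^-1 * s))); first by rewrite !mulgA.
by rewrite (idemC (idem_rs t) (idem_ds s)) !mulgA mulgVg.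
Qed.

End InverseMonoidTheory.

(* The free left R-module on X, i.e. the finitely supported functions X -> R.
   The module structure on {malg R[X]} in monalg needs 1 != 0 in R; it is
   redone here so that the zero ring is allowed. *)
Definition freemod (R : pzRingType) (X : choiceType) : Type := {malg R[X]}.
HB.instance Definition _ R X := GRing.Zmodule.on (freemod R X).

Section FreeModule.
Variables (R : pzRingType) (X : choiceType).
Implicit Types (g h : freemod R X) (x : X) (c : R).

Definition free_scale c g : freemod R X := [malg x in msupp g => c * g@_x].

Lemma free_scaleE c g x : (free_scale c g)@_x = c * g@_x.
Proof. by rewrite mcoeffE; case: msuppP; rewrite ?mulr0. Qed.

Fact free_scaleA c d g : free_scale c (free_scale d g) = free_scale (c * d) g.
Proof. by apply/malgP=> x; rewrite !free_scaleE mulrA. Qed.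

Fact free_scale1 : left_id 1 free_scale.
Proof. by move=> g; apply/malgP=> x; rewrite free_scaleE mul1r. Qed.

Fact free_scaleDr : right_distributive free_scale +%R.
Proof. by move=> c g h; apply/malgP=> x; rewrite !(mcoeffD, free_scaleE) mulrDr. Qed.

Fact free_scaleDl g : {morph free_scale^~ g : c d / c + d}.
Proof. by move=> c d; apply/malgP=> x; rewrite !(mcoeffD, free_scaleE) mulrDl. Qed.

HB.instance Definition _ := GRing.Zmodule_isLmodule.Build R (freemod R X)
  free_scaleA free_scale1 free_scaleDr free_scaleDl.

Definition gen x : freemod R X := << 1 *g x >>.

Lemma freeZE c g x : (c *: g : freemod R X)@_x = c * g@_x.
Proof. exact: free_scaleE. Qed.

Lemma freeE g : g = \sum_(x <- msupp g) g@_x *: gen x.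
Proof.
rewrite [LHS]monalgE; apply: eq_bigr => x _; apply/malgP=> y.
by rewrite freeZE !mcoeffU mulrnAr mulr1.
Qed.

Section LinearExtension.
Variables (M : lmodType R) (F : X -> M).

(* The R-linear map sending gen x to F x. *)
Definition lext g : M := \sum_(x <- msupp g) g@_x *: F x.

Lemma lextw (d : {fset X}) g : (msupp g `<=` d)%fset ->
  lext g = \sum_(x <- d) g@_x *: F x.
Proof.
move=> gd; rewrite /lext (big_fset_incl _ gd) //= => x _ xg.
by rewrite mcoeff_outdom // scale0r.
Qed.

Fact lext_linear : linear lext.
Proof.
move=> c g h.
rewrite (@lextw (msupp (c *: g + h) `|` msupp g `|` msupp h)%fset); last first.
  by rewrite -fsetUA fsubsetUl.
rewrite (@lextw (msupp (c *: g + h) `|` msupp g `|` msupp h)%fset g); last first.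
  by rewrite fsetUAC fsubsetUr.
rewrite (@lextw (msupp (c *: g + h) `|` msupp g `|` msupp h)%fset h); last first.
  by rewrite fsubsetUr.
rewrite scaler_sumr -big_split /=; apply: eq_bigr => x _.
by rewrite mcoeffD freeZE scalerDl scalerA.
Qed.

HB.instance Definition _ :=
  GRing.isLinear.Build R (freemod R X) M _ lext lext_linear.

Lemma lext_gen x : lext (gen x) = F x.
Proof.
rewrite (@lextw [fset x]%fset) ?msuppU_le // big_seq_fset1.
by rewrite mcoeffUU scale1r.
Qed.
End LinearExtension.

Lemma linear_gen (M : lmodType R) (f g : freemod R X -> M) :
  linear f -> linear g -> (forall x, f (gen x) = g (gen x)) -> f =1 g.
Proof.
move=> lf lg fg a.
pose fl : {linear freemod R X -> M} := HB.pack f (GRing.isLinear.Build _ _ _ _ f lf).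
pose gl : {linear freemod R X -> M} := HB.pack g (GRing.isLinear.Build _ _ _ _ g lg).
rewrite (freeE a) -[f _]/(fl _) -[g _]/(gl _) !linear_sum; apply: eq_bigr => x _.
by rewrite !linearZ /=; congr (_ *: _); exact: fg.
Qed.
End FreeModule.

Arguments gen {R X} x.

Section BilinearExtension.
Variables (K : comPzRingType) (X Y : choiceType) (M : lmodType K).
Variable F : X -> Y -> M.

(* The K-bilinear map sending (gen x, gen y) to F x y. *)
Definition bilext (a : freemod K X) (b : freemod K Y) : M :=
  lext (fun x => lext (F x) b) a.

Fact bilext_linearl b : linear (bilext^~ b).
Proof. exact: lext_linear. Qed.

Fact bilext_linearr a : linear (bilext a).
Proof.
move=> c b b'; rewrite /bilext /lext scaler_sumr -big_split /=.
apply: eq_bigr => x _; rewrite -/(lext _ _) -/(lext _ b) -/(lext _ b').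
by rewrite lext_linear scalerDr !scalerA mulrC.
Qed.

Lemma bilext_gen x y : bilext (gen x) (gen y) = F x y.
Proof. by rewrite /bilext !lext_gen. Qed.
End BilinearExtension.

Definition semigroup_algebra (K : comPzRingType) (S : monoidType) : Type :=
  freemod K S.
HB.instance Definition _ K S := GRing.Lmodule.on (semigroup_algebra K S).

Section SemigroupAlgebra.
Variables (K : comPzRingType) (S : monoidType).
Local Notation KS := (semigroup_algebra K S).
Implicit Types a b c : KS.

Definition sgen (s : S) : KS := gen s.

Definition salg_mul a b : KS := bilext (fun s t => sgen (s * t)%g) a b.

Let mulL a := bilext_linearr (fun s t => sgen (s * t)%g) a : linear (salg_mul a).
Let mulR b := bilext_linearl (fun s t => sgen (s * t)%g) b : linear (salg_mul^~ b).
Let mul_gen s t : salg_mul (sgen s) (sgen t) = sgen (s * t)%g.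
Proof. exact: bilext_gen. Qed.

Fact salg_mulA : associative salg_mul.
Proof.
move=> a b c.
apply: (linear_gen (f := fun a => salg_mul a (salg_mul b c))
  (g := fun a => salg_mul (salg_mul a b) c)) => [||s].
- exact: mulR.
- by move=> k x y /=; rewrite !mulR.
apply: (linear_gen (f := fun b => salg_mul (gen s) (salg_mul b c))
  (g := fun b => salg_mul (salg_mul (gen s) b) c)) => [||t].
- by move=> k x y /=; rewrite mulR mulL.
- by move=> k x y /=; rewrite mulL mulR.
apply: (linear_gen (f := fun c => salg_mul (gen s) (salg_mul (gen t) c))
  (g := fun c => salg_mul (salg_mul (gen s) (gen t)) c)) => [||u].
- by move=> k x y /=; rewrite !mulL.
- by move=> k x y /=; rewrite !mulL.
by rewrite !mul_gen mulgA.
Qed.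

Fact salg_mul1 : left_id (sgen 1%g) salg_mul.
Proof.
apply: (linear_gen (f := salg_mul (sgen 1%g)) (g := id)) => [||s].
- exact: mulL.
- by [].
by rewrite (mul_gen 1%g s) mul1g.
Qed.

Fact salg_mulr1 : right_id (sgen 1%g) salg_mul.
Proof.
apply: (linear_gen (f := salg_mul^~ (sgen 1%g)) (g := id)) => [||s].
- exact: mulR.
- by [].
by rewrite (mul_gen s 1%g) mulg1.
Qed.

Fact salg_mulDl : left_distributive salg_mul +%R.
Proof. by move=> a b c; have := mulR c 1 a b; rewrite !scale1r. Qed.

Fact salg_mulDr : right_distributive salg_mul +%R.
Proof. by move=> a b c; have := mulL a 1 b c; rewrite !scale1r. Qed.

HB.instance Definition _ := GRing.Zmodule_isPzRing.Build KS
  salg_mulA salg_mul1 salg_mulr1 salg_mulDl salg_mulDr.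

Lemma sgenM s t : sgen s * sgen t = sgen (s * t)%g.
Proof. exact: mul_gen. Qed.

Lemma salg_scaleAl (k : K) a b : (k *: a) * b = k *: (a * b).
Proof.
have : (k *: a + 0) * b = k *: (a * b) + 0 * b := mulR b k a 0.
by rewrite mul0r !addr0.
Qed.

Lemma salg_scaleAr (k : K) a b : a * (k *: b) = k *: (a * b).
Proof.
have : a * (k *: b + 0) = k *: (a * b) + a * 0 := mulL a k b 0.
by rewrite mulr0 !addr0.
Qed.

Lemma salg_scaleE (k : K) a : k *: a = (k *: (1 : KS)) * a.
Proof. by rewrite salg_scaleAl mul1r. Qed.

Lemma salg_central (k : K) a : (k *: (1 : KS)) * a = a * (k *: (1 : KS)).
Proof. by rewrite salg_scaleAl salg_scaleAr mul1r mulr1. Qed.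
End SemigroupAlgebra.

(* The K-module underlying a KS-module. *)
Definition underK (K : comPzRingType) (S : monoidType)
  (V : lmodType (semigroup_algebra K S)) : Type := V.

Section UnderlyingModule.
Variables (K : comPzRingType) (S : monoidType).
Variable V : lmodType (semigroup_algebra K S).
Local Notation KS := (semigroup_algebra K S).

HB.instance Definition _ := GRing.Zmodule.on (underK V).

Definition underK_scale (k : K) (v : underK V) : underK V :=
  (k *: (1 : KS)) *: (v : V).

Fact underK_scaleA k l v :
  underK_scale k (underK_scale l v) = underK_scale (k * l) v.
Proof. by rewrite /underK_scale scalerA -salg_scaleE scalerA. Qed.

Fact underK_scale1 : left_id 1 underK_scale.
Proof. by move=> v; rewrite /underK_scale !scale1r. Qed.

Fact underK_scaleDr : right_distributive underK_scale +%R.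
Proof. by move=> k u v; rewrite /underK_scale scalerDr. Qed.

Fact underK_scaleDl v : {morph underK_scale^~ v : k l / k + l}.
Proof. by move=> k l; rewrite /underK_scale !scalerDl. Qed.

HB.instance Definition _ := GRing.Zmodule_isLmodule.Build K (underK V)
  underK_scaleA underK_scale1 underK_scaleDr underK_scaleDl.

Lemma underKZE (k : K) (v : underK V) : k *: v = (k *: (1 : KS)) *: (v : V).
Proof. by []. Qed.

Lemma underKC (k : K) (a : KS) (v : V) :
  k *: (a *: v : underK V) = a *: (k *: (v : underK V) : V).
Proof. by rewrite !underKZE !scalerA salg_central. Qed.
End UnderlyingModule.

Definition idempotents (S : inverseMonoidType) : Type := {e : S | idem e}.
HB.instance Definition _ S := Choice.on (idempotents S).

Definition conj_idem (S : inverseMonoidType) (s : S) (e : idempotents S) :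
  idempotents S := exist _ (s * val e * s^-1)%g (idem_conj s (valP e)).

Definition idem_module (K : comPzRingType) (S : inverseMonoidType) : Type :=
  freemod K (idempotents S).
HB.instance Definition _ K S := GRing.Zmodule.on (idem_module K S).

Section IdempotentModule.
Variables (K : comPzRingType) (S : inverseMonoidType).
Local Notation KS := (semigroup_algebra K S).
Local Notation KE := (idem_module K S).
Implicit Types (a b : KS) (x y : KE).

(* The action s . e = s e s^-1, extended K-bilinearly. *)
Definition idem_scale a x : KE :=
  bilext (fun s e => gen (conj_idem s e) : freemod K (idempotents S)) a x.

Let scaleL a := bilext_linearr
  (fun s e => gen (conj_idem s e) : freemod K (idempotents S)) a.
Let scaleR x := bilext_linearl
  (fun s e => gen (conj_idem s e) : freemod K (idempotents S)) x.

Lemma idem_scale_gen s e : idem_scale (sgen K s) (gen e) = gen (conj_idem s e).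
Proof. exact: bilext_gen. Qed.

Fact idem_scaleA a b x : idem_scale a (idem_scale b x) = idem_scale (a * b) x.
Proof.
pose F := freemod K (idempotents S).
apply: (linear_gen (f := fun a : freemod K S => idem_scale a (idem_scale b x) : F)
  (g := fun a : KS => idem_scale (a * b) x : F)) => [||s].
- exact: scaleR.
- by move=> k u v /=; rewrite mulrDl salg_scaleAl; exact: scaleR.
apply: (linear_gen (f := fun b : freemod K S => idem_scale (gen s) (idem_scale b x) : F)
  (g := fun b : KS => idem_scale ((gen s : KS) * b) x : F)) => [||t].
- by move=> k u v /=; rewrite [idem_scale (_ + _) _]scaleR; exact: scaleL.
- by move=> k u v /=; rewrite mulrDr salg_scaleAr; exact: scaleR.
apply: (linear_gen (f := fun x : F => idem_scale (gen s) (idem_scale (gen t) x) : F)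
  (g := fun x : F => idem_scale ((gen s : KS) * gen t) x : F)) => [||e].
- by move=> k u v /=; rewrite [idem_scale _ (_ + _)]scaleL; exact: scaleL.
- exact: scaleL.
rewrite [(gen s : KS) * gen t]sgenM !idem_scale_gen; congr (gen _).
by apply: val_inj; rewrite /= invgM !mulgA.
Qed.

Fact idem_scale1 : left_id 1 idem_scale.
Proof.
apply: (linear_gen (f := idem_scale 1) (g := id)) => [||e].
- exact: scaleL.
- by [].
rewrite idem_scale_gen; congr (gen _).
by apply: val_inj; rewrite /= mul1g invg1 mulg1.
Qed.

Fact idem_scaleDr : right_distributive idem_scale +%R.
Proof. by move=> a x y; have := scaleL a 1 x y; rewrite !scale1r. Qed.

Fact idem_scaleDl x : {morph idem_scale^~ x : a b / a + b}.
Proof. by move=> a b; have := scaleR x 1 a b; rewrite !scale1r. Qed.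

HB.instance Definition _ := GRing.Zmodule_isLmodule.Build KS KE
  idem_scaleA idem_scale1 idem_scaleDr idem_scaleDl.
End IdempotentModule.

Record submodule (R : pzRingType) (M : lmodType R) := Submodule {
  submodule_pred :> {pred M};
  submoduleP : submod_closed submodule_pred
}.

HB.instance Definition _ (R : pzRingType) (M : lmodType R) (N : submodule M) :=
  GRing.isSubmodClosed.Build R M (submodule_pred N) (submoduleP N).

Section SubmoduleTypes.
Variables (R : pzRingType) (M : lmodType R) (N : submodule M).

Definition submod : Type := {x : M | x \in submodule_pred N}.
Definition to_submod (x : M) (Nx : x \in submodule_pred N) : submod :=
  exist (fun y : M => y \in submodule_pred N) x Nx.
HB.instance Definition _ := SubChoice.on submod.
HB.instance Definition _ := [SubChoice_isSubLmodule of submod by <:].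

Definition quotmod : Type := Quotient.quot (submodule_pred N).
HB.instance Definition _ := EqQuotient.on quotmod.
HB.instance Definition _ := ZmodQuotient.on quotmod.

Definition quot_scale (c : R) (x : quotmod) : quotmod :=
  \pi_quotmod (c *: repr x).

Lemma eq_quotmod (x y : M) :
  (\pi_quotmod x == \pi_quotmod y) = (x - y \in submodule_pred N).
Proof. by rewrite Quotient.idealrBE. Qed.

Lemma quot_scale_pi c (x : M) : quot_scale c (\pi_quotmod x) = \pi_quotmod (c *: x).
Proof.
have h : repr (\pi_quotmod x) - x \in submodule_pred N by rewrite -eq_quotmod reprK.
by apply/eqP; rewrite eq_quotmod -scalerBr; exact: rpredZ.
Qed.

Fact quot_scaleA c d x : quot_scale c (quot_scale d x) = quot_scale (c * d) x.
Proof. by rewrite -[x]reprK !quot_scale_pi scalerA ?reprK. Qed.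

Fact quot_scale1 : left_id 1 quot_scale.
Proof. by move=> x; rewrite -[x]reprK quot_scale_pi scale1r. Qed.

Fact quot_scaleDr : right_distributive quot_scale +%R.
Proof.
move=> c x y; rewrite -[x]reprK -[y]reprK.
by rewrite -raddfD !quot_scale_pi scalerDr raddfD.
Qed.

Fact quot_scaleDl x : {morph quot_scale^~ x : c d / c + d}.
Proof.
by move=> c d; rewrite -[x]reprK !quot_scale_pi scalerDl raddfD.
Qed.

HB.instance Definition _ := GRing.Zmodule_isLmodule.Build R quotmod
  quot_scaleA quot_scale1 quot_scaleDr quot_scaleDl.
End SubmoduleTypes.

Definition ker_submodule (R : pzRingType) (M N : lmodType R)
  (f : {linear M -> N}) : submodule M.
Proof.
exists (fun x => f x == 0); split; first by rewrite unfold_in linear0.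
by move=> c x y; rewrite !unfold_in linearP => /eqP-> /eqP->; rewrite scaler0 addr0.
Defined.

Definition isomorphic (R : pzRingType) (M N : lmodType R) : Prop :=
  exists f : {linear M -> N}, bijective f.

Record cochain_complex (R : pzRingType) := CochainComplex {
  cochain : nat -> lmodType R;
  codiff : forall n, {linear cochain n -> cochain n.+1};
  codiffK : forall n x, codiff n.+1 (codiff n x) = 0
}.

Section Cohomology.
Variables (R : pzRingType) (C : cochain_complex R).

Definition cocycles n : submodule (cochain C n) := ker_submodule (codiff C n).

(* In degree 0 the incoming map is 0 -> C^0. *)
Definition is_coboundary n : cochain C n -> Prop :=
  match n with
  | 0 => fun x => x = 0
  | m.+1 => fun x => exists y, x = codiff C m y
  end.

Fact is_coboundary_closed n : submod_closed
  (fun z : submod (cocycles n) => `[< is_coboundary (val z) >]).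
Proof.
case: n => [|n]; split.
- by apply/asboolP; exact: (raddf0 val).
- move=> c x y; rewrite !unfold_in => /asboolP /= x0 /asboolP /= y0.
  by apply/asboolP; apply: (etrans (linearP val c x y)); rewrite /= x0 y0 scaler0 addr0.
- by apply/asboolP; exists 0; rewrite linear0 (raddf0 val).
- move=> c x y; rewrite !unfold_in => /asboolP /= [u xu] /asboolP /= [v yv].
  by apply/asboolP; exists (c *: u + v); apply: (etrans (linearP val c x y)); rewrite /= xu yv linearP.
Qed.

Definition coboundaries n : submodule (submod (cocycles n)) :=
  Submodule (@is_coboundary_closed n).

Definition cohomology n : lmodType R := quotmod (coboundaries n).
End Cohomology.

Definition surjective (A B : Type) (f : A -> B) := forall y, exists x, f x = y.

Definition projective (R : pzRingType) (P : lmodType R) : Prop :=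
  forall (A B : lmodType R) (g : {linear A -> B}) (f : {linear P -> B}),
    surjective g -> exists h : {linear P -> A}, forall x, g (h x) = f x.

(* An exact sequence ... -> P_1 -> P_0 -> M -> 0 with every P_n projective. *)
Record projective_resolution (R : pzRingType) (M : lmodType R) :=
  ProjectiveResolution {
    pres : nat -> lmodType R;
    pres_diff : forall n, {linear pres n.+1 -> pres n};
    pres_aug : {linear pres 0 -> M};
    pres_projective : forall n, projective (pres n);
    pres_aug_surj : surjective pres_aug;
    pres_exact0 : forall x, pres_aug x = 0 <-> exists y, pres_diff 0 y = x;
    pres_exactS : forall n x,
      pres_diff n x = 0 <-> exists y, pres_diff n.+1 y = x
  }.

(* Every module has a projective resolution: cover it by the free module on
   its elements, then cover the kernel, and so on. *)
Section FreeResolution.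
Variable R : pzRingType.

Lemma freemod_projective (X : choiceType) : projective (freemod R X).
Proof.
move=> A B g f gsurj.
have [s sP] := choice (fun x : X => gsurj (f (gen x))).
exists (lext s) => a.
apply: (linear_gen (f := fun a => g (lext s a)) (g := f)) => [||x].
- by move=> c u v /=; rewrite !linearP.
- exact: linearP.
by rewrite lext_gen sP.
Qed.

Definition free_cover (M : lmodType R) : {linear freemod R M -> M} :=
  lext (fun x : M => x).

Lemma free_cover_surj M : surjective (free_cover M).
Proof. by move=> x; exists (gen x); exact: lext_gen. Qed.

Variable M : lmodType R.

Fixpoint syzygy n : lmodType R :=
  if n is m.+1 then submod (ker_submodule (free_cover (syzygy m))) else M.

Definition free_res_diff n :
    {linear freemod R (syzygy n.+1) -> freemod R (syzygy n)} :=
  (val : submod (ker_submodule (free_cover (syzygy n))) -> _)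
  \o free_cover (syzygy n.+1).

Lemma free_res_diffP n x : free_cover (syzygy n) x = 0 <->
  exists y, free_res_diff n y = x.
Proof.
split=> [x0|[y <-]]; last by apply/eqP; exact: (valP (free_cover (syzygy n.+1) y)).
have [y yx] := @free_cover_surj (syzygy n.+1)
  (to_submod (N := ker_submodule (free_cover (syzygy n))) (x := x) (introT eqP x0)).
by exists y; rewrite /= yx.
Qed.

Lemma free_res_exactS n x :
  free_res_diff n x = 0 <-> exists y, free_res_diff n.+1 y = x.
Proof.
rewrite -free_res_diffP; split=> [h|h]; first exact: val_inj.
by rewrite /= h.
Qed.

Definition free_resolution : projective_resolution M :=
  ProjectiveResolution (fun n => @freemod_projective (syzygy n))
    (@free_cover_surj M) (@free_res_diffP 0) free_res_exactS.
End FreeResolution.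

Section Ext.
Variables (K : comPzRingType) (S : monoidType).
Local Notation KS := (semigroup_algebra K S).

Section Hom.
Variables P V : lmodType KS.

Fact hom_closed : submod_closed
  (fun f : P -> underK V => `[< linear (f : P -> V) >]).
Proof.
split; first by apply/asboolP => c x y; rewrite /= scaler0 addr0.
move=> k f g; rewrite !unfold_in => /asboolP lf /asboolP lg.
apply/asboolP => c x y; rewrite -[LHS]/(k *: f (c *: x + y) + g (c *: x + y)).
rewrite lf lg -[X in _ = c *: X + _]/(k *: f x + g x) -[X in _ = _ + X]/(k *: f y + g y).
by rewrite [k *: (_ + _)]scalerDr underKC [c *: (_ + _)]scalerDr addrACA.
Qed.

(* Hom_KS(P, V) as a K-module, with (k f)(x) = k f(x). *)
Definition hom_submodule : submodule (P -> underK V) := Submodule hom_closed.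
Definition Hom : lmodType K := submod hom_submodule.
End Hom.

Section Precomposition.
Variables (P Q V : lmodType KS) (d : {linear Q -> P}).

Fact precomp_subproof (f : Hom P V) :
  (val f \o d : Q -> underK V) \in submodule_pred (hom_submodule Q V).
Proof.
have /asboolP lf := valP f; apply/asboolP => c x y /=.
by rewrite linearP lf.
Qed.

Definition precomp (f : Hom P V) : Hom Q V := to_submod (precomp_subproof f).

Fact precomp_linear : linear precomp.
Proof. by move=> k f g; apply: val_inj. Qed.

HB.instance Definition _ :=
  GRing.isLinear.Build K (Hom P V) (Hom Q V) _ precomp precomp_linear.
End Precomposition.

Variables (M V : lmodType KS) (P : projective_resolution M).

Fact hom_complexK n (f : Hom (pres P n) V) :
  precomp (pres_diff P n.+1) (precomp (pres_diff P n) f) = 0.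
Proof.
apply: val_inj; apply/funext => x /=.
have -> : pres_diff P n (pres_diff P n.+1 x) = 0.
  by apply/(@pres_exactS _ _ P n); exists x.
have /asboolP lf := valP f; have := lf (-1) 0 0.
by rewrite scaler0 addr0 scaleN1r addNr.
Qed.

Definition hom_complex : cochain_complex K :=
  @CochainComplex K (fun n => Hom (pres P n) V)
    (fun n => @precomp _ _ V (pres_diff P n)) hom_complexK.

(* Ext^n_KS(M, V) computed from the projective resolution P of M.  It does not
   depend on P up to isomorphism, and free_resolution M is one choice of P. *)
Definition Ext n : lmodType K := cohomology hom_complex n.
End Ext.

Section Cochains.
Variables (K : comPzRingType) (S : inverseMonoidType).
Local Notation KS := (semigroup_algebra K S).
Variable V : lmodType KS.

Definition tprod n (s : n.-tuple S) : S := (\prod_(i < n) tnth s i)%g.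

(* v \in r(s) V *)
Definition in_rV (s : S) (v : V) : Prop := exists u : V, v = sgen K (rs s) *: u.

Lemma in_rVP s v : in_rV s v <-> sgen K (rs s) *: v = v.
Proof.
split=> [[u ->]|<-]; last by exists v.
by rewrite scalerA sgenM rs_rs.
Qed.

Lemma in_rV0 s : in_rV s 0.
Proof. by exists 0; rewrite scaler0. Qed.

Lemma in_rVD s u v : in_rV s u -> in_rV s v -> in_rV s (u + v).
Proof. by move=> [u' ->] [v' ->]; exists (u' + v'); rewrite scalerDr. Qed.

Lemma in_rVN s u : in_rV s u -> in_rV s (- u).
Proof. by move=> [u' ->]; exists (- u'); rewrite scalerN. Qed.

Lemma in_rVsign s i u : in_rV s u -> in_rV s ((-1) ^+ i *: u).
Proof.
elim: i => [|i IH] su; first by rewrite expr0 scale1r.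
by rewrite exprS -scalerA scaleN1r; apply/in_rVN/IH.
Qed.

Lemma in_rVZ s k u : in_rV s u -> in_rV s (k *: (u : underK V)).
Proof. by move=> [u' ->]; exists (k *: (u' : underK V)); rewrite underKC. Qed.

Lemma in_rV_rs s v : in_rV s (sgen K (rs s) *: v).
Proof. by exists v. Qed.

Lemma in_rVM s t v : in_rV t v -> in_rV (s * t)%g (sgen K s *: v).
Proof.
move=> /in_rVP <-; exists (sgen K s *: v).
by rewrite !scalerA !sgenM rs_mul.
Qed.

Fact cochains_closed n : submod_closed
  (fun f : n.-tuple S -> underK V => `[< forall s, in_rV (tprod s) (f s) >]).
Proof.
split; first by apply/asboolP => s; exact: in_rV0.
move=> k f g; rewrite !unfold_in => /asboolP sf /asboolP sg.
by apply/asboolP => s; apply: in_rVD => //; exact: in_rVZ.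
Qed.

Definition poscochains n : submodule (n.-tuple S -> underK V) :=
  Submodule (@cochains_closed n).

Definition cochains n : lmodType K :=
  if n is m.+1 then submod (poscochains m.+1) else underK V.

Definition delta0_fun (x : V) (s : 1.-tuple S) : V :=
  sgen K (thead s) *: x - sgen K (rs (thead s)) *: x.

(* For s = (s_0, ..., s_n): (s_1, ..., s_n), (s_0, ..., s_(n-1)) and
   (s_0, ..., s_i s_(i+1), ..., s_n). *)
Definition tdrop_first n (s : n.+1.-tuple S) : n.-tuple S :=
  [tuple tnth s (lift ord0 j) | j < n].

Definition tdrop_last n (s : n.+1.-tuple S) : n.-tuple S :=
  [tuple tnth s (widen_ord (leqnSn n) j) | j < n].

Definition tmerge n (i : 'I_n) (s : n.+1.-tuple S) : n.-tuple S :=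
  [tuple if (j < i)%N then tnth s (widen_ord (leqnSn n) j)
         else if j == i
           then (tnth s (widen_ord (leqnSn n) j) * tnth s (lift ord0 j))%g
         else tnth s (lift ord0 j) | j < n].

(* Indices are shifted by one with respect to (s_1, ..., s_(n+1)): the i-th
   term of the sum, i = 0, ..., n-1, merges the 1-based entries i+1, i+2. *)
Definition deltaS_fun n (f : n.-tuple S -> V) (s : n.+1.-tuple S) : V :=
  sgen K (thead s) *: f (tdrop_first s)
  + \sum_(i < n) (-1) ^+ i.+1 *: f (tmerge i s)
  + (-1) ^+ n.+1 *: (sgen K (rs (tprod s)) *: f (tdrop_last s)).

Lemma tprod_drop_first n (s : n.+1.-tuple S) :
  (thead s * tprod (tdrop_first s))%g = tprod s.
Proof.
rewrite /tprod big_ord_recl; congr (_ * _)%g.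
by apply: eq_bigr => i _; rewrite tnth_mktuple.
Qed.

Lemma tprod_merge n (i : 'I_n) (s : n.+1.-tuple S) :
  tprod (tmerge i s) = tprod s.
Proof.
pose F k := nth 1%g s k.
have natE m (i0 : nat) : (i0 < m)%N ->
    (\prod_(j < m) (if (j < i0)%N then F j else
       if j == i0 :> nat then F j * F j.+1 else F j.+1) = \prod_(j < m.+1) F j)%g.
  elim: m => // m IH; rewrite ltnS leq_eqVlt => /predU1P[->|im].
    rewrite big_ord_recr /= ltnn eqxx [RHS]big_ord_recr [in RHS]big_ord_recr /=.
    by rewrite mulgA; congr (_ * _ * _)%g; apply: eq_bigr => j _; rewrite ltn_ord.
  rewrite big_ord_recr /= IH // ltnNge (ltnW im) /= gtn_eqF //.
  by rewrite [RHS]big_ord_recr.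
transitivity (\prod_(j < n.+1) F j)%g; last first.
  by apply: eq_bigr => j _; rewrite (tnth_nth 1%g).
rewrite -(natE n i) //; apply: eq_bigr => j _; rewrite tnth_mktuple.
by rewrite !(tnth_nth 1%g).
Qed.

Fact delta0_subproof x : delta0_fun x \in submodule_pred (poscochains 1).
Proof.
apply/asboolP => s; rewrite /tprod big_ord1.
apply: in_rVD; last by apply/in_rVN/in_rV_rs.
by rewrite -[sgen K _ *: x]/(_ *: _) -[thead s in X in in_rV _ X]rs_mull -sgenM -scalerA; exact: in_rV_rs.
Qed.

Definition delta0 (x : cochains 0) : cochains 1 := to_submod (delta0_subproof x).

Fact deltaS_subproof n (f : cochains n.+1) :
  deltaS_fun (val f) \in submodule_pred (poscochains n.+2).
Proof.
have /asboolP rf := valP f; apply/asboolP => s.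
apply: in_rVD; last by apply/in_rVsign/in_rV_rs.
apply: in_rVD.
  by rewrite -tprod_drop_first; apply/in_rVM/rf.
elim/big_ind: _ => [|u v|i _]; [exact: in_rV0|exact: in_rVD|].
by rewrite -(tprod_merge i); apply/in_rVsign/rf.
Qed.

Definition deltaS n (f : cochains n.+1) : cochains n.+2 :=
  to_submod (deltaS_subproof f).

Fact delta0_linear : linear delta0.
Proof.
move=> k x y; apply: val_inj; apply/funext => s /=.
rewrite /delta0_fun -[RHS]/(k *: (delta0_fun x s : underK V) + delta0_fun y s).
rewrite /delta0_fun [k *: (_ - _)]scalerBr !underKC !scalerDr opprD.
by rewrite addrACA.
Qed.

Lemma deltaS_funP n k (f g : n.-tuple S -> underK V) (s : n.+1.-tuple S) :
  deltaS_fun (k *: f + g) s =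
  k *: (deltaS_fun f s : underK V) + (deltaS_fun g s : underK V).
Proof.
have E t : (k *: f + g) t = k *: f t + g t by [].
rewrite /deltaS_fun !E [k *: (_ + _ + _)]scalerDr [k *: (_ + _)]scalerDr !underKC.
rewrite [sgen K _ *: (_ + _)]scalerDr [sgen K (rs _) *: (_ + _)]scalerDr.
rewrite [(-1) ^+ _ *: (_ + _)]scalerDr.
rewrite [k *: (\sum_(i < _) _)]scaler_sumr.
under eq_bigr do rewrite E scalerDr -underKC.
by rewrite big_split /= [X in X + _ = _]addrACA; exact: addrACA.
Qed.

Fact deltaS_linear n : linear (@deltaS n).
Proof. by move=> k f g; apply: val_inj; apply/funext => s; exact: deltaS_funP. Qed.

HB.instance Definition _ :=
  GRing.isLinear.Build K (cochains 0) (cochains 1) _ delta0 delta0_linear.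
HB.instance Definition _ n :=
  GRing.isLinear.Build K (cochains n.+1) (cochains n.+2) _
    (@deltaS n) (@deltaS_linear n).

Definition delta n : {linear cochains n -> cochains n.+1} :=
  match n with
  | 0 => delta0
  | m.+1 => @deltaS m
  end.

End Cochains.

(* Main.v *)
Require Import Defs.
From HB Require Import structures.
From mathcomp Require Import all_boot all_algebra.
From mathcomp Require Import boolp functions zify.

(* Let B_n be the direct sum of the left ideals KS r(s_1 ... s_n), with
   generator [s_1|...|s_n], over all n-tuples.  With the differential of the
   bar resolution, augmented by s[] |-> r(s) onto KE(S), these modules form a
   projective resolution of KE(S): the K-linear map
   s[s_1|...|s_n] |-> r(s)[s|s_1|...|s_n] is a contracting homotopy.  A
   KS-linear map from B_n to V amounts to choosing the image of each
   [s_1|...|s_n] in r(s_1 ... s_n)V, so Hom(B_n, V) is C^n(S, V), and the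
   differentials correspond; in particular delta delta = 0 comes from B.  The
   comparison theorem for projective resolutions does the rest. *)

Set Implicit Arguments.
Unset Strict Implicit.
Unset Printing Implicit Defensive.

Import GRing.Theory.
Local Open Scope ring_scope.

(** * Comparison of projective resolutions *)

Section Modules.
Variable R : pzRingType.

Lemma isomorphic_trans (L M N : lmodType R) :
  isomorphic L M -> isomorphic M N -> isomorphic L N.
Proof.
move=> [f bf] [g bg].
pose h : {linear L -> N} := g \o f.
by exists h; exact: bij_comp.
Qed.

Lemma quotmod_isomorphic (M M' : lmodType R) (N : submodule M)
    (N' : submodule M') (f : {linear M -> M'}) (g : {linear M' -> M}) :
  {in N, forall x, f x \in submodule_pred N'} ->
  {in N', forall y, g y \in submodule_pred N} ->
  (forall x, g (f x) - x \in submodule_pred N) ->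
  (forall y, f (g y) - y \in submodule_pred N') ->
  isomorphic (quotmod N) (quotmod N').
Proof.
move=> fN gN gfN fgN.
pose F (x : quotmod N) : quotmod N' := \pi_(quotmod N')%qT (f (repr x)).
pose G (y : quotmod N') : quotmod N := \pi_(quotmod N)%qT (g (repr y)).
have Fpi x : F (\pi_(quotmod N)%qT x) = \pi_(quotmod N')%qT (f x).
  apply/eqP; rewrite eq_quotmod -linearB; apply: fN.
  by rewrite -eq_quotmod reprK.
have Gpi y : G (\pi_(quotmod N')%qT y) = \pi_(quotmod N)%qT (g y).
  apply/eqP; rewrite eq_quotmod -linearB; apply: gN.
  by rewrite -eq_quotmod reprK.
have linF : linear F.
  move=> c x y; rewrite -[x]reprK -[y]reprK.
  rewrite -[c *: _]/(quot_scale _ _) quot_scale_pi -raddfD !Fpi linearP.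
  by rewrite -[c *: _ in RHS]/(quot_scale _ _) quot_scale_pi raddfD.
pose Fl : {linear quotmod N -> quotmod N'} :=
  HB.pack F (GRing.isLinear.Build _ _ _ _ F linF).
exists Fl; exists G => x; rewrite -[x]reprK /=.
  by rewrite Fpi Gpi; apply/eqP; rewrite eq_quotmod.
by rewrite Gpi Fpi; apply/eqP; rewrite eq_quotmod.
Qed.

Section Restriction.
Variables (M M' : lmodType R) (N' : submodule M') (f : {linear M -> M'}).
Hypothesis fN' : forall x, f x \in submodule_pred N'.

Fact corestr_linear : linear (fun x => to_submod (fN' x)).
Proof. by move=> c x y; apply: val_inj; exact: linearP. Qed.

Definition corestr : {linear M -> submod N'} :=
  HB.pack (fun x => to_submod (fN' x))
    (GRing.isLinear.Build _ _ _ _ (fun x => to_submod (fN' x)) corestr_linear).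

End Restriction.

Lemma projective_lift (P A B : lmodType R) (p : {linear A -> B})
    (h : {linear P -> B}) :
  projective P -> (forall x, exists a, p a = h x) ->
  exists k : {linear P -> A}, forall x, p (k x) = h x.
Proof.
move=> Pproj hp.
have closed : submod_closed (fun y : B => `[< exists a, p a = y >]).
  split; first by apply/asboolP; exists 0; rewrite linear0.
  move=> c x y /asboolP[a <-] /asboolP[b <-]; apply/asboolP.
  by exists (c *: a + b); rewrite linearP.
pose N := Submodule closed.
have pN a : p a \in submodule_pred N by apply/asboolP; exists a.
have hN x : h x \in submodule_pred N by exact/asboolP.
have surj : surjective (corestr pN).
  case=> y yN; have /asboolP[a ay] := yN; exists a.
  exact: val_inj.
have [k kP] := Pproj _ _ (corestr pN) (corestr hN) surj.
by exists k => x; have /(congr1 val) := kP x.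
Qed.

End Modules.

Section CochainMaps.
Variables (R : pzRingType) (C D : cochain_complex R).
Variable f : forall n, {linear cochain C n -> cochain D n}.
Hypothesis fP : forall n x, f n.+1 (codiff C n x) = codiff D n (f n x).

Lemma cocycles_cochain_map n (x : submod (cocycles C n)) :
  f n (val x) \in submodule_pred (cocycles D n).
Proof. by have /eqP x0 := valP x; apply/eqP; rewrite -fP x0 linear0. Qed.

Definition cocycle_map n : {linear submod (cocycles C n) -> submod (cocycles D n)} :=
  corestr (f := f n \o (val : submod (cocycles C n) -> _))
    (@cocycles_cochain_map n).

Lemma is_coboundary_cochain_map n x :
  is_coboundary x -> is_coboundary (f n x).
Proof.
case: n x => [|n] x /=; first by move->; rewrite linear0.
by case=> y ->; exists (f n y); rewrite fP.
Qed.

End CochainMaps.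

Lemma cohomology_isomorphic (R : pzRingType) (C D : cochain_complex R)
    (f : forall n, {linear cochain C n -> cochain D n})
    (g : forall n, {linear cochain D n -> cochain C n}) :
  (forall n x, f n.+1 (codiff C n x) = codiff D n (f n x)) ->
  (forall n x, g n.+1 (codiff D n x) = codiff C n (g n x)) ->
  (forall n x, codiff C n x = 0 -> is_coboundary (g n (f n x) - x)) ->
  (forall n x, codiff D n x = 0 -> is_coboundary (f n (g n x) - x)) ->
  forall n, isomorphic (cohomology C n) (cohomology D n).
Proof.
move=> fP gP gf fg n.
apply: (@quotmod_isomorphic _ _ _ _ _ (cocycle_map fP n) (cocycle_map gP n)).
- move=> x /asboolP xb; apply/asboolP.
  exact: is_coboundary_cochain_map.
- move=> x /asboolP xb; apply/asboolP.
  exact: is_coboundary_cochain_map.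
- by move=> x; apply/asboolP; have /eqP/gf := valP x.
- by move=> x; apply/asboolP; have /eqP/fg := valP x.
Qed.

Lemma dependent_choice (T : nat -> Type) (I : forall n, T n -> Prop)
    (r : forall n, T n -> T n.+1 -> Prop) (x0 : T 0) :
  I 0 x0 -> (forall n x, I n x -> exists2 y, r n x y & I n.+1 y) ->
  exists2 u : forall n, T n, u 0 = x0 & forall n, r n (u n) (u n.+1).
Proof.
move=> I0 step.
have next n (x : {x : T n | I n x}) :
    {y : {y : T n.+1 | I n.+1 y} | r n (sval x) (sval y)}.
  case: x => x Ix; have [y rxy Iy] := cid2 (step n x Ix).
  by exists (exist _ y Iy).
pose fix u n : {x : T n | I n x} :=
  if n is m.+1 then sval (next m (u m)) else exist _ x0 I0.
by exists (fun n => sval (u n)) => // n; exact: (svalP (next n (u n))).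
Qed.

Section Comparison.
Variables (R : pzRingType) (M : lmodType R).

Section CycleLifting.
Variable P : projective_resolution M.

Definition is_cycle n : pres P n -> Prop :=
  match n with
  | 0 => fun x => pres_aug P x = 0
  | m.+1 => fun x => pres_diff P m x = 0
  end.

Lemma is_cycleP n (x : pres P n) :
  is_cycle x <-> exists y, pres_diff P n y = x.
Proof. by case: n x => [|n] x; [exact: pres_exact0 | exact: pres_exactS]. Qed.

Lemma pres_diffK n x : pres_diff P n (pres_diff P n.+1 x) = 0.
Proof. by apply/(@pres_exactS _ _ P n); exists x. Qed.

End CycleLifting.

Lemma chain_map_exists (P Q : projective_resolution M) :
  exists2 f : forall n, {linear pres P n -> pres Q n},
    forall x, pres_aug Q (f 0 x) = pres_aug P x
    & forall n x, pres_diff Q n (f n.+1 x) = f n (pres_diff P n x).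
Proof.
have [f0 f0P] := pres_projective (pres_aug P) (@pres_aug_surj _ _ Q).
pose T n := {linear pres P n -> pres Q n} : Type.
pose I n (f : T n) := forall x, is_cycle (f (pres_diff P n x)).
pose r n (f : T n) (f' : T n.+1) :=
  forall x, pres_diff Q n (f' x) = f (pres_diff P n x).
have [||f f0E fP] := @dependent_choice T I r f0.
- by move=> x /=; rewrite f0P; apply/pres_exact0; exists x.
- move=> n f If.
  have [f' f'P] := projective_lift (p := pres_diff Q n)
    (h := f \o pres_diff P n) (@pres_projective _ _ P n.+1)
    (fun x => proj1 (is_cycleP _) (If x)).
  by exists f' => // x; rewrite /= f'P /= pres_diffK linear0.
by exists f; rewrite ?f0E.
Qed.

Lemma chain_homotopy_exists (P Q : projective_resolution M)
    (f : forall n, {linear pres P n -> pres Q n}) :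
  (forall x, pres_aug Q (f 0 x) = 0) ->
  (forall n x, pres_diff Q n (f n.+1 x) = f n (pres_diff P n x)) ->
  exists2 s : forall n, {linear pres P n -> pres Q n.+1},
    forall x, pres_diff Q 0 (s 0 x) = f 0 x
    & forall n x, pres_diff Q n.+1 (s n.+1 x) = f n.+1 x - s n (pres_diff P n x).
Proof.
move=> f0 fP.
have [s0 s0P] := projective_lift (p := pres_diff Q 0) (h := f 0)
  (@pres_projective _ _ P 0) (fun x => proj1 (@pres_exact0 _ _ Q _) (f0 x)).
pose T n := {linear pres P n -> pres Q n.+1} : Type.
pose I n (s : T n) :=
  forall x, pres_diff Q n (f n.+1 x - s (pres_diff P n x)) = 0.
pose r n (s : T n) (s' : T n.+1) :=
  forall x, pres_diff Q n.+1 (s' x) = f n.+1 x - s (pres_diff P n x).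
have [||s s0E sP] := @dependent_choice T I r s0.
- by move=> x; rewrite linearB fP s0P subrr.
- move=> n s Is.
  have [s' s'P] := projective_lift (p := pres_diff Q n.+1)
    (h := f n.+1 \- (s \o pres_diff P n)) (@pres_projective _ _ P n.+1)
    (fun x => proj1 (@pres_exactS _ _ Q _ _) (Is x)).
  exists s' => // x.
  by rewrite linearB fP s'P /= pres_diffK linear0 subr0 subrr.
by exists s; rewrite ?s0E.
Qed.

End Comparison.

Section ExtComparison.
Variables (K : comPzRingType) (S : monoidType).
Local Notation KS := (semigroup_algebra K S).
Variables (M V : lmodType KS).

Lemma precomp_chain_endomorphism (P : projective_resolution M)
    (f : forall n, {linear pres P n -> pres P n}) :
  (forall x, pres_aug P (f 0 x) = pres_aug P x) ->
  (forall n x, pres_diff P n (f n.+1 x) = f n (pres_diff P n x)) ->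
  forall n (u : cochain (hom_complex V P) n), codiff (hom_complex V P) n u = 0 ->
  is_coboundary (precomp (f n) u - u : cochain (hom_complex V P) n).
Proof.
move=> f0 fP.
pose g n : {linear pres P n -> pres P n} := f n \- idfun.
have [||s s0 sS] := @chain_homotopy_exists _ _ P P g.
- by move=> x; rewrite /= linearB f0 subrr.
- by move=> n x; rewrite /= linearB fP.
have homB (Q : lmodType KS) (u : Defs.Hom Q V) x y : val u (x - y) = val u x - val u y.
  have /asboolP lu := valP u.
  by rewrite addrC -scaleN1r lu scaleN1r addrC.
move=> n u u0.
have u0E x : val u (pres_diff P n x) = 0.
  by have /(congr1 (fun v : Defs.Hom _ V => val v x)) := u0.
case: n => [|n] in u u0 u0E *.
  apply: val_inj; apply/funext => x.
  by have := u0E (s 0 x); rewrite s0 /= homB.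
exists (precomp (s n) u); apply: val_inj; apply/funext => x.
have := u0E (s n.+1 x); rewrite sS /= !homB => /eqP; rewrite subr_eq0 => /eqP.
exact.
Qed.

Lemma Ext_isomorphic (P Q : projective_resolution M) n :
  isomorphic (Ext V P n) (Ext V Q n).
Proof.
have [f f0 fP] := chain_map_exists P Q.
have [g g0 gP] := chain_map_exists Q P.
apply: (@cohomology_isomorphic _ (hom_complex V P) (hom_complex V Q)
  (fun n => @precomp _ _ _ _ V (g n)) (fun n => @precomp _ _ _ _ V (f n))) => {n}.
- by move=> n u; apply: val_inj; apply/funext => x /=; rewrite gP.
- by move=> n u; apply: val_inj; apply/funext => x /=; rewrite fP.
- move=> n u u0.
  suff : is_coboundary (precomp (g n \o f n) u - u : cochain (hom_complex V P) n).
    by congr is_coboundary; congr (_ - _); exact: val_inj.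
  apply: (@precomp_chain_endomorphism P (fun n => g n \o f n)) => //= [x|m x].
    by rewrite g0 f0.
  by rewrite gP fP.
- move=> n u u0.
  suff : is_coboundary (precomp (f n \o g n) u - u : cochain (hom_complex V Q) n).
    by congr is_coboundary; congr (_ - _); exact: val_inj.
  apply: (@precomp_chain_endomorphism Q (fun n => f n \o g n)) => //= [x|m x].
    by rewrite f0 g0.
  by rewrite fP gP.
Qed.

End ExtComparison.

(** * The bar resolution of KE(S) *)

Section BarCells.
Variable S : inverseMonoidType.
Implicit Types (e s u v : S) (p : nat -> S).
Local Open Scope group_scope.

Lemma rs_conj u s : rs (u * s) = u * rs s * u^-1.
Proof. by rewrite /rs invgM !mulgA. Qed.

Lemma invg_rs s : (rs s)^-1 = rs s.
Proof. by rewrite /rs invgM invgK. Qed.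

Lemma rsK s : rs (rs s) = rs s.
Proof. by rewrite -[LHS]/(rs s * (rs s)^-1) invg_rs rs_rs. Qed.

Lemma rs_idem e : idem e -> rs e = e.
Proof.
by move=> /eqP ee; rewrite -[LHS]/(e * e^-1) -(@invg_unique _ e e) ?ee.
Qed.

Lemma rs_mulC s u : rs s * rs u = rs u * rs s.
Proof. exact: idemC (idem_rs s) (idem_rs u). Qed.

Lemma rs_mul_le s u : rs (s * u) * rs s = rs (s * u).
Proof. by rewrite rs_mulC rs_conj -[rs s]/(s * s^-1) !mulgA mulgVg. Qed.

Definition merge_at (i : nat) p (k : nat) : S :=
  if (k < i)%N then p k else if k == i then p k * p k.+1 else p k.+1.

Definition pprod p (k : nat) : S := \prod_(j < k.+1) p j.

Lemma eq_pprod p p' k : (forall j, (j <= k)%N -> p j = p' j) ->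
  pprod p k = pprod p' k.
Proof. by move=> pp'; apply: eq_bigr => j _; apply: pp'; rewrite -ltnS. Qed.

(* In terms of partial products, merging two neighbours omits one of them. *)
Lemma pprod_merge i p k : pprod (merge_at i p) k = pprod p (bump i k).
Proof.
rewrite /bump; elim: k => [|k IH]; rewrite /pprod ?big_ord1 /merge_at.
  by case: i => [|i] /=; rewrite ?big_ord_recl ?big_ord1 ?big_ord0 ?mulg1.
rewrite big_ord_recr /= -/(pprod (merge_at i p) k) IH.
have [ik|ki|ki] := ltngtP k.+1 i.
- by rewrite leqNgt (ltnW ik) /= [RHS]big_ord_recr.
- by rewrite -ltnS ki /= !add1n [RHS]big_ord_recr.
- by rewrite -ki ltnn add1n add0n [RHS]big_ord_recr /= [in RHS]big_ord_recr /= mulgA.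
Qed.

Lemma merge_merge i j p k : (i < j)%N ->
  merge_at i (merge_at j p) k = merge_at j.-1 (merge_at i p) k.
Proof.
case: j => // j; rewrite ltnS /= /merge_at => ij.
have [ki|ik|ki] := ltngtP k i.
- by have [-> ->] : (k < j.+1)%N = true /\ (k < j)%N = true by lia.
- rewrite ltnS eqSS; have -> : (k.+1 < i)%N = false by lia.
  have -> : (k.+1 == i) = false by lia.
  by case: ltngtP.
- rewrite ki !ltnS ij eqSS.
  have -> : (i.+1 < i)%N = false by lia.
  have -> : (i.+1 == i) = false by lia.
  by case: ltngtP ij => //= _ _; rewrite mulgA.
Qed.

(* For i = n no two entries are merged: the last one is dropped. *)
Definition face n (i : nat) (t : n.+1.-tuple S) : n.-tuple S :=
  [tuple merge_at i (nth 1 t) j | j < n].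

Lemma nth_mktuple_nat n (F : nat -> S) k : (k < n)%N ->
  nth 1 [tuple F j | j < n] k = F k.
Proof. by move=> kn; rewrite (nth_mktuple _ _ (Ordinal kn)). Qed.

Lemma nth_face n i (t : n.+1.-tuple S) k : (k < n)%N ->
  nth 1 (face i t) k = merge_at i (nth 1 t) k.
Proof. exact: nth_mktuple_nat. Qed.

Lemma eq_tuple_nth n (t u : n.-tuple S) :
  (forall k, (k < n)%N -> nth 1 t k = nth 1 u k) -> t = u.
Proof.
by move=> tu; apply: eq_from_tnth => i; rewrite !(tnth_nth 1) tu.
Qed.

Lemma face_face n i j (t : n.+2.-tuple S) : (i < j)%N ->
  face i (face j t) = face j.-1 (face i t).
Proof.
move=> ij; apply: eq_tuple_nth => k kn; rewrite !nth_face //.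
have nth_merge a b : merge_at a (nth 1 (face b t)) k =
    merge_at a (merge_at b (nth 1 t)) k.
  by rewrite [LHS]/merge_at !nth_face // ltnW.
by rewrite !nth_merge merge_merge.
Qed.

Lemma pprod_cons s (t : seq S) k :
  pprod (nth 1 (s :: t)) k.+1 = s * pprod (nth 1 t) k.
Proof. by rewrite /pprod big_ord_recl. Qed.

Lemma tprodE n (t : n.+1.-tuple S) : tprod t = pprod (nth 1 t) n.
Proof. by apply: eq_bigr => i _; rewrite (tnth_nth 1). Qed.

(* The tuple (s, s_1, ..., s_n) stands for the element s of the summand
   KS r(s_1 ... s_n) with index (s_1, ..., s_n) of the bar resolution; the
   condition amounts to s = s r(s_1 ... s_n). *)
Definition is_cell n : pred (n.+1.-tuple S) := fun t =>
  [forall k : 'I_n.+1, rs (pprod (nth 1 t) k) == rs (nth 1 t 0)].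

Lemma is_cellP n (t : n.+1.-tuple S) :
  reflect (forall k, (k <= n)%N -> rs (pprod (nth 1 t) k) = rs (nth 1 t 0))
    (is_cell t).
Proof.
apply: (iffP forallP) => [h k|h k]; last by apply/eqP/h; rewrite -ltnS.
by rewrite -ltnS => kn; apply/eqP/(h (Ordinal kn)).
Qed.

Definition bar_cell n : Type := {t : n.+1.-tuple S | is_cell t}.
HB.instance Definition _ n := Choice.on (bar_cell n).

Lemma is_cell_face n i (x : bar_cell n.+1) : is_cell (face i (val x)).
Proof.
have /is_cellP h := valP x.
suff fh k : (k <= n)%N ->
    rs (pprod (nth 1 (face i (val x))) k) = rs (nth 1 (val x) 0).
  apply/is_cellP => k kn; rewrite fh // -(fh 0%N) // /pprod.
  by rewrite big_ord1.
move=> kn; rewrite (@eq_pprod _ (merge_at i (nth 1 (val x)))).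
  by rewrite pprod_merge h // /bump -add1n leq_add // leq_b1.
by move=> j jk; rewrite nth_face // ltnS (leq_trans jk).
Qed.

Definition bar_face n i (x : bar_cell n.+1) : bar_cell n :=
  exist _ (face i (val x)) (is_cell_face i x).

Lemma is_cell_act n u (x : bar_cell n) :
  @is_cell n [tuple of u * nth 1 (val x) 0 :: behead (val x)].
Proof.
have /is_cellP h := valP x; apply/is_cellP => k kn /=.
have -> : pprod (nth 1 (u * nth 1 (val x) 0 :: behead (val x))) k =
    u * pprod (nth 1 (val x)) k.
  rewrite /pprod !big_ord_recl mulgA; congr (_ * _).
  by apply: eq_bigr => j _; rewrite /= nth_behead.
by rewrite rs_conj h // -rs_conj.
Qed.

Definition bar_act n u (x : bar_cell n) : bar_cell n :=
  exist (@is_cell n) _ (is_cell_act u x).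

Lemma bar_cell_inj n (x y : bar_cell n) :
  nth 1 (val x) 0 = nth 1 (val y) 0 -> behead (val x) = behead (val y) -> x = y.
Proof.
case: x y => -[[|a s] st] sc [[[|b t] tt] tc] //= ab stt.
by apply/val_inj/val_inj; rewrite /= ab stt.
Qed.

Lemma bar_act1 n (x : bar_cell n) : bar_act 1 x = x.
Proof. by apply: bar_cell_inj; rewrite //= mul1g. Qed.

Lemma bar_actM n u v (x : bar_cell n) : bar_act (u * v) x = bar_act u (bar_act v x).
Proof. by apply: bar_cell_inj; rewrite //= mulgA. Qed.

Lemma bar_face_act n i u (x : bar_cell n.+1) :
  bar_face i (bar_act u x) = bar_act u (bar_face i x).
Proof.
apply: val_inj; apply: eq_tuple_nth => -[|k] kn; rewrite [LHS]nth_face //=.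
  by rewrite nth_face // /merge_at; case: i => [|i] //=; rewrite nth_behead mulgA.
by rewrite nth_behead nth_face // /merge_at /= !nth_behead.
Qed.

Lemma bar_face_face n i j (x : bar_cell n.+2) : (i < j)%N ->
  bar_face i (bar_face j x) = bar_face j.-1 (bar_face i x).
Proof. by move=> ij; apply: val_inj; exact: face_face. Qed.

Lemma is_cell_cons n (x : bar_cell n) :
  is_cell [tuple of rs (nth 1 (val x) 0) :: val x].
Proof.
have /is_cellP h := valP x; apply/is_cellP => -[|k] kn /=.
  by rewrite /pprod big_ord1.
by rewrite pprod_cons rs_conj h // invg_rs !rs_rs rsK.
Qed.

Definition bar_cons n (x : bar_cell n) : bar_cell n.+1 :=
  exist (@is_cell n.+1) _ (is_cell_cons x).

Lemma bar_face0_cons n (x : bar_cell n) : bar_face 0 (bar_cons x) = x.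
Proof.
apply: val_inj; apply: eq_tuple_nth => -[|k] kn; rewrite nth_face //.
by rewrite /merge_at /= rs_mull.
Qed.

Lemma rs_bar_face n i (x : bar_cell n.+1) :
  rs (nth 1 (val (bar_face i x)) 0) = rs (nth 1 (val x) 0).
Proof.
have /is_cellP h := valP x; rewrite [val _]/= nth_face // /merge_at.
case: i => //=.
by rewrite -(h 1%N) // /pprod !big_ord_recl big_ord0 mulg1.
Qed.

Lemma bar_faceS_cons n i (x : bar_cell n.+1) :
  bar_face i.+1 (bar_cons x) = bar_cons (bar_face i x).
Proof.
apply: val_inj; apply: eq_tuple_nth => -[|k] kn; rewrite nth_face //.
  by rewrite [RHS]rs_bar_face.
by rewrite [RHS]/= nth_face.
Qed.

Lemma is_cell_unit n (t : n.-tuple S) : is_cell [tuple of rs (tprod t) :: t].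
Proof.
apply/is_cellP => -[|k] kn /=; first by rewrite /pprod big_ord1.
rewrite pprod_cons rs_conj invg_rs rsK.
suff le_t : rs (tprod t) * rs (pprod (nth 1 t) k) = rs (tprod t).
  by rewrite le_t rs_rs.
case: n => // n in t kn *.
have [v ->] : exists v, tprod t = pprod (nth 1 t) k * v.
  rewrite tprodE; elim: n {t} (nth 1 t) kn => [|n IH] p.
    by rewrite ltnS leqn0 => /eqP->; exists 1; rewrite mulg1.
  rewrite ltnS leq_eqVlt => /predU1P[->|/IH-/(_ p)[v vE]].
    by exists 1; rewrite mulg1.
  by exists (v * p n.+1); rewrite mulgA -vE /pprod [LHS]big_ord_recr.
exact: rs_mul_le.
Qed.

Definition bar_unit n (t : n.-tuple S) : bar_cell n :=
  exist (@is_cell n) _ (is_cell_unit t).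

Definition bar_index n (x : bar_cell n) : n.-tuple S := [tuple of behead (val x)].

Lemma bar_index_unit n (t : n.-tuple S) : bar_index (bar_unit t) = t.
Proof. exact: val_inj. Qed.

Lemma bar_head_rs n (x : bar_cell n) :
  nth 1 (val x) 0 * rs (tprod (bar_index x)) = nth 1 (val x) 0.
Proof.
case: n x => [|n] x; first by rewrite /tprod big_ord0 /rs invg1 !mulg1.
have /is_cellP/(_ n.+1 (leqnn _)) := valP x.
rewrite -rs_mul tprodE; set q := pprod _ n.
suff -> : pprod (nth 1 (val x)) n.+1 = nth 1 (val x) 0 * q.
  by move=> ->; rewrite rs_mull.
rewrite /pprod big_ord_recl; congr (_ * _).
by apply: eq_bigr => j _; rewrite /= nth_behead.
Qed.

Lemma bar_cellE n (x : bar_cell n) :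
  x = bar_act (nth 1 (val x) 0) (bar_unit (bar_index x)).
Proof. by apply: bar_cell_inj; rewrite //= bar_head_rs. Qed.

End BarCells.

Lemma alternating_sum_eq0 (M : zmodType) (m : nat) (F : nat -> nat -> M) :
  (forall i j, (i <= j < m)%N -> F i j.+1 = - F j i) ->
  \sum_(j < m.+1) \sum_(i < m) F i j = 0.
Proof.
move=> FN.
have -> : \sum_(j < m.+1) \sum_(i < m) F i j =
    \sum_(j < m.+1) \sum_(i < m | (i < j)%N) F i j +
    \sum_(j < m.+1) \sum_(i < m | ~~ (i < j)%N) F i j.
  by rewrite -big_split; apply: eq_bigr => j _; exact: bigID.
rewrite big_ord_recl big_pred0 ?add0r; last by [].
rewrite [X in _ + X]big_ord_recr /= [X in _ + (_ + X)]big_pred0 ?addr0; last first.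
  by move=> i; rewrite ltn_ord.
rewrite [X in _ + X](exchange_big_dep predT) //= -big_split big1 // => j _ /=.
rewrite (eq_bigr (fun i : 'I_m => - F j i)) => [|i]; last first.
  by rewrite ltnS => ij; apply: FN; rewrite ij ltn_ord.
rewrite sumrN; apply/eqP; rewrite addr_eq0 eqr_opp; apply/eqP.
by apply: eq_bigl => i; rewrite -leqNgt ltnS.
Qed.

Lemma scale_signS (R : pzRingType) (M : lmodType R) i j (x : M) :
  (-1) ^+ j.+1 *: ((-1) ^+ i *: x) = - ((-1) ^+ i *: ((-1) ^+ j *: x)).
Proof. by rewrite exprS mulN1r scaleNr !scalerA -!exprD addnC. Qed.

Section KSLinear.
Variables (K : comPzRingType) (S : monoidType).
Local Notation KS := (semigroup_algebra K S).

Lemma scale_underK_linearl (M : lmodType KS) (v : M) :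
  linear (fun a : freemod K S => (a : KS) *: v : underK M).
Proof.
move=> k a b /=; rewrite [((_ + b : freemod K S) : KS) *: v]scalerDl; congr (_ + _).
by rewrite underKZE scalerA -salg_scaleE.
Qed.

Lemma scale_underK_linearr (M : lmodType KS) (a : KS) :
  linear (fun v : underK M => a *: (v : M) : underK M).
Proof. by move=> k u v /=; rewrite [a *: _]scalerDr underKC. Qed.

Lemma linear_underK (M N : lmodType KS) (f : M -> N) :
  linear f -> linear (f : underK M -> underK N).
Proof. by move=> lf k u v; rewrite !underKZE; exact: lf. Qed.

End KSLinear.

Definition bar (K : comPzRingType) (S : inverseMonoidType) (n : nat) : Type :=
  freemod K (bar_cell S n).
HB.instance Definition _ K S n := GRing.Zmodule.on (bar K S n).

Section BarModule.
Variables (K : comPzRingType) (S : inverseMonoidType) (n : nat).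
Local Notation KS := (semigroup_algebra K S).
Local Notation FX := (freemod K (bar_cell S n)).
Implicit Types (a b : KS) (x y : bar K S n).

Definition bar_scale a x : bar K S n :=
  bilext (fun s c => gen (bar_act s c) : FX) a x.

Let scaleL a := bilext_linearr (fun s c => gen (bar_act s c) : FX) a.
Let scaleR x := bilext_linearl (fun s c => gen (bar_act s c) : FX) x.

Lemma bar_scale_gen s c : bar_scale (sgen K s) (gen c) = gen (bar_act s c).
Proof. exact: bilext_gen. Qed.

Fact bar_scaleA a b x : bar_scale a (bar_scale b x) = bar_scale (a * b) x.
Proof.
apply: (linear_gen (f := fun a : freemod K S => bar_scale a (bar_scale b x) : FX)
  (g := fun a : KS => bar_scale (a * b) x : FX)) => [||s].
- exact: scaleR.
- by move=> k u v /=; rewrite mulrDl salg_scaleAl; exact: scaleR.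
apply: (linear_gen
  (f := fun b : freemod K S => bar_scale (gen s) (bar_scale b x) : FX)
  (g := fun b : KS => bar_scale ((gen s : KS) * b) x : FX)) => [||t].
- by move=> k u v /=; rewrite [bar_scale (_ + _) _]scaleR; exact: scaleL.
- by move=> k u v /=; rewrite mulrDr salg_scaleAr; exact: scaleR.
apply: (linear_gen
  (f := fun x : FX => bar_scale (gen s) (bar_scale (gen t) x) : FX)
  (g := fun x : FX => bar_scale ((gen s : KS) * gen t) x : FX)) => [||c].
- by move=> k u v /=; rewrite [bar_scale _ (_ + _)]scaleL; exact: scaleL.
- exact: scaleL.
by rewrite [(gen s : KS) * gen t]sgenM !bar_scale_gen bar_actM.
Qed.

Fact bar_scale1 : left_id 1 bar_scale.
Proof.
apply: (linear_gen (f := bar_scale 1) (g := id)) => [||c].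
- exact: scaleL.
- by [].
by rewrite bar_scale_gen bar_act1.
Qed.

Fact bar_scaleDr : right_distributive bar_scale +%R.
Proof. by move=> a x y; have := scaleL a 1 x y; rewrite !scale1r. Qed.

Fact bar_scaleDl x : {morph bar_scale^~ x : a b / a + b}.
Proof. by move=> a b; have := scaleR x 1 a b; rewrite !scale1r. Qed.

HB.instance Definition _ := GRing.Zmodule_isLmodule.Build KS (bar K S n)
  bar_scaleA bar_scale1 bar_scaleDr bar_scaleDl.

Lemma bar_underKZ k (x : bar K S n) : k *: (x : underK (bar K S n)) = k *: (x : FX).
Proof.
have E : bar_scale (k *: (1 : KS)) x = k *: (bar_scale 1 x : FX) + bar_scale 0 x.
  by have := scaleR x k (1 : KS) 0; rewrite addr0.
rewrite underKZE [LHS]E bar_scale1 -[bar_scale 0 x]/((0 : KS) *: x).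
by rewrite scale0r addr0.
Qed.

Definition bar_gen (c : bar_cell S n) : bar K S n := gen c : FX.

Lemma bar_genZ s c : sgen K s *: bar_gen c = bar_gen (bar_act s c).
Proof. exact: bar_scale_gen. Qed.

Section Maps.
Variable M : lmodType KS.

Lemma bar_linear (f : FX -> underK M) : linear f ->
  (forall s c, f (gen (bar_act s c)) = sgen K s *: (f (gen c) : M)) ->
  linear (f : bar K S n -> M).
Proof.
move=> lf f_act a x y.
have fD u v : f (u + v) = f u + f v by have := lf 1 u v; rewrite !scale1r.
rewrite [LHS]fD; congr (_ + _).
have gen_scale s : (fun x : FX => f (bar_scale (sgen K s) x)) =1
    (fun x => sgen K s *: (f x : M) : underK M).
  apply: linear_gen => [||c].
  - by move=> k u v /=; rewrite [bar_scale _ _]scaleL lf.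
  - by move=> k u v /=; rewrite lf; exact: scale_underK_linearr.
  rewrite bar_scale_gen.
  exact: f_act.
have scale : (fun a : freemod K S => f (bar_scale a x)) =1
    (fun a => (a : KS) *: (f x : M) : underK M).
  apply: linear_gen => [||s].
  - by move=> k u v /=; rewrite [bar_scale _ _]scaleR lf.
  - exact: scale_underK_linearl.
  exact: gen_scale.
exact: scale.
Qed.

Lemma bar_linear_eq (f g : bar K S n -> M) : linear f -> linear g ->
  (forall t, f (bar_gen (bar_unit t)) = g (bar_gen (bar_unit t))) -> f =1 g.
Proof.
move=> lf lg fg.
have lin (h : bar K S n -> M) : linear h -> linear (h : FX -> underK M).
  by move=> lh k u v; rewrite -bar_underKZ; exact: (linear_underK lh).
apply: (linear_gen (lin f lf) (lin g lg)) => c.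
rewrite -[gen c]/(bar_gen c) (bar_cellE c) -bar_genZ.
by rewrite (GRing.scalable_linear lf) (GRing.scalable_linear lg) fg.
Qed.

Variable a : n.-tuple S -> M.

Definition bar_lift : bar K S n -> M :=
  lext (fun c : bar_cell S n =>
    sgen K (nth 1%g (val c) 0) *: a (bar_index c) : underK M).

Lemma bar_lift_gen c :
  bar_lift (bar_gen c) = sgen K (nth 1%g (val c) 0) *: a (bar_index c).
Proof. exact: (@lext_gen _ _ (underK M)). Qed.

Fact bar_lift_linear : linear bar_lift.
Proof.
apply: bar_linear; first exact: lext_linear.
move=> s c; rewrite [LHS]bar_lift_gen [bar_lift (gen c)]bar_lift_gen.
by rewrite scalerA sgenM; congr (_ *: a _); exact: val_inj.
Qed.

HB.instance Definition _ :=
  GRing.isLinear.Build KS (bar K S n) M _ bar_lift bar_lift_linear.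

Lemma bar_lift_unit t :
  bar_lift (bar_gen (bar_unit t)) = sgen K (rs (tprod t)) *: a t.
Proof. by rewrite bar_lift_gen bar_index_unit. Qed.

End Maps.

Lemma bar_gen_unit_rV t : in_rV (tprod t) (bar_gen (bar_unit t)).
Proof.
apply/in_rVP; rewrite bar_genZ; congr bar_gen.
by apply: bar_cell_inj => //=; rewrite rs_rs.
Qed.

Lemma bar_projective : projective (bar K S n).
Proof.
move=> A B g f gsurj.
have [a aP] := choice (fun t => gsurj (f (bar_gen (bar_unit t)))).
exists (bar_lift a).
apply: (@bar_linear_eq _ (g \o bar_lift a)) => [||t /=]; try exact: linearP.
by rewrite bar_lift_unit linearZ /= aP -linearZ (proj1 (in_rVP _ _) (bar_gen_unit_rV t)).
Qed.

End BarModule.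

Section BarResolution.
Variables (K : comPzRingType) (S : inverseMonoidType).
Local Notation KS := (semigroup_algebra K S).
Local Notation FX n := (freemod K (bar_cell S n)).

Definition bar_diff n : bar K S n.+1 -> bar K S n :=
  lext (fun c : bar_cell S n.+1 => \sum_(i < n.+2) (-1) ^+ i *: (gen (bar_face i c) : FX n)).

Lemma bar_diff_genK n (c : bar_cell S n.+1) :
  bar_diff (gen c) = \sum_(i < n.+2) (-1) ^+ i *: (gen (bar_face i c) : FX n).
Proof. by rewrite [LHS]lext_gen. Qed.

Lemma bar_diff_gen n (c : bar_cell S n.+1) : bar_diff (bar_gen K c) =
  \sum_(i < n.+2) (-1) ^+ i *: bar_gen K (bar_face i c).
Proof.
rewrite [LHS]bar_diff_genK; apply: eq_bigr => i _.
by rewrite -signr_odd -[in RHS]signr_odd !scaler_sign.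
Qed.

Fact bar_diff_linear n : linear (@bar_diff n).
Proof.
apply: bar_linear => [k x y|s c].
  by rewrite bar_underKZ; exact: (@lext_linear _ _ (FX n)).
rewrite [LHS]bar_diff_gen [bar_diff (gen c)]bar_diff_gen scaler_sumr.
apply: eq_bigr => i _; rewrite bar_face_act -bar_genZ.
by rewrite -signr_odd !scaler_sign; case: odd; rewrite ?scalerN.
Qed.

HB.instance Definition _ n :=
  GRing.isLinear.Build KS (bar K S n.+1) (bar K S n) _ (@bar_diff n)
    (@bar_diff_linear n).

Lemma bar_diffK n (x : bar K S n.+2) : bar_diff (bar_diff x) = 0.
Proof.
apply: (@bar_linear_eq _ _ _ _ (@bar_diff n \o @bar_diff n.+1) \0) => [||t]; try exact: linearP.
rewrite /= bar_diff_gen linear_sum /=.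
under eq_bigr => j _ do rewrite linearZ /= bar_diff_gen scaler_sumr.
apply: (@alternating_sum_eq0 _ _ (fun i j => (-1) ^+ j *:
  ((-1) ^+ i *: bar_gen K (bar_face i (bar_face j (bar_unit t)))))) => i j /andP[ij _].
by rewrite bar_face_face // scale_signS.
Qed.

End BarResolution.

Section BarExactness.
Variables (K : comPzRingType) (S : inverseMonoidType).
Local Notation KS := (semigroup_algebra K S).
Local Notation KE := (idem_module K S).
Local Notation FX n := (freemod K (bar_cell S n)).
Local Notation FE := (freemod K (idempotents S)).

Lemma idem_module_underKZ (k : K) (x : KE) :
  k *: (x : underK KE) = k *: (x : FE).
Proof.
have E : idem_scale (k *: (1 : KS)) x = k *: (idem_scale 1 x : FE) + idem_scale 0 x.
  have := bilext_linearl (fun s e => gen (conj_idem s e) : FE) x k (1 : KS) 0.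
  by rewrite addr0.
rewrite underKZE [LHS]E idem_scale1 -[idem_scale 0 x]/((0 : KS) *: x).
by rewrite scale0r addr0.
Qed.

Definition rs_idempotent (s : S) : idempotents S :=
  exist (fun e => idem e) (rs s) (idem_rs s).

Lemma rs_idempotent_val (e : idempotents S) : rs_idempotent (val e) = e.
Proof. by apply: val_inj; rewrite /= rs_idem // (valP e). Qed.

Lemma conj_rs_idempotent u s : conj_idem u (rs_idempotent s) = rs_idempotent (u * s)%g.
Proof. by apply: val_inj; rewrite /= rs_conj. Qed.

Definition bar_aug : bar K S 0 -> KE :=
  lext (fun c : bar_cell S 0 => gen (rs_idempotent (nth 1%g (val c) 0)) : FE).

Lemma bar_aug_gen (c : bar_cell S 0) :
  bar_aug (bar_gen K c) = (gen (rs_idempotent (nth 1%g (val c) 0)) : FE).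
Proof. by rewrite [LHS]lext_gen. Qed.

Fact bar_aug_linear : linear bar_aug.
Proof.
apply: bar_linear => [k x y|s c].
  by rewrite idem_module_underKZ; exact: (@lext_linear _ _ FE).
rewrite [LHS]bar_aug_gen [bar_aug (gen c)]bar_aug_gen.
by rewrite [RHS]idem_scale_gen conj_rs_idempotent.
Qed.

HB.instance Definition _ :=
  GRing.isLinear.Build KS (bar K S 0) KE _ bar_aug bar_aug_linear.

Definition bar_section : FE -> FX 0 :=
  lext (fun e => gen (bar_act (val e) (bar_unit [tuple])) : FX 0).

Lemma bar_section_gen (e : idempotents S) :
  bar_section (gen e) = gen (bar_act (val e) (bar_unit [tuple])).
Proof. exact: lext_gen. Qed.

Lemma bar_sectionK (x : KE) : bar_aug (bar_section x) = x.
Proof.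
apply: (linear_gen (f := fun x : FE => bar_aug (bar_section x) : FE)
  (g := id)) => [k u v /=||e].
- rewrite /bar_section (lext_linear _ k u v).
  exact: (@lext_linear _ _ FE).
- by [].
rewrite bar_section_gen [LHS]bar_aug_gen; congr (gen _).
rewrite -[RHS]rs_idempotent_val; congr rs_idempotent.
by rewrite /= /tprod big_ord0 /rs invg1 !mulg1.
Qed.

Definition bar_htpy n : FX n -> FX n.+1 :=
  lext (fun c : bar_cell S n => gen (bar_cons c) : FX n.+1).

HB.instance Definition _ n :=
  GRing.isLinear.Build K (FX n) (FX n.+1) _ (@bar_htpy n)
    (@lext_linear _ _ (FX n.+1) _).

Lemma bar_htpy_gen n (c : bar_cell S n) : bar_htpy (gen c) = gen (bar_cons c).
Proof. exact: lext_gen. Qed.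

Lemma bar_diff_linearK n : linear (@bar_diff K S n : FX n.+1 -> FX n).
Proof. exact: lext_linear. Qed.

Lemma bar_htpyP0 (x : FX 0) :
  (bar_diff (bar_htpy x) : FX 0) = x - bar_section (bar_aug x).
Proof.
pose G x : FX 0 := x - bar_section (bar_aug x).
apply: (linear_gen (f := fun x : FX 0 => bar_diff (bar_htpy x) : FX 0)
  (g := G)) => [k u v|k u v|c].
- by rewrite linearP bar_diff_linearK.
- rewrite /G [bar_aug _](@lext_linear _ _ FE) /bar_section (@lext_linear _ _ (FX 0)).
  by rewrite scalerBr opprD addrACA.
have aug : bar_section (bar_aug (gen c)) = gen (bar_face 1 (bar_cons c)).
  rewrite [bar_aug _]bar_aug_gen bar_section_gen; congr gen.
  apply: val_inj; apply: eq_tuple_nth => -[|//] _.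
  by rewrite nth_face //= /merge_at /= /tprod big_ord0 /rs invg1 !mulg1.
rewrite bar_htpy_gen [LHS]bar_diff_genK /G aug.
by rewrite big_ord_recl big_ord1 bar_face0_cons scale1r scaleN1r.
Qed.

Lemma bar_htpyPS n (x : FX n.+1) :
  (bar_diff (bar_htpy x) : FX n.+1) = x - bar_htpy (bar_diff x).
Proof.
pose G x : FX n.+1 := x - bar_htpy (bar_diff x).
apply: (linear_gen (f := fun x : FX n.+1 => bar_diff (bar_htpy x) : FX n.+1)
  (g := G)) => [k u v|k u v|c].
- by rewrite linearP bar_diff_linearK.
- rewrite /G bar_diff_linearK linearP.
  by rewrite scalerBr opprD addrACA.
rewrite /G bar_htpy_gen [LHS]bar_diff_genK bar_diff_genK [bar_htpy _]linear_sum.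
rewrite big_ord_recl bar_face0_cons scale1r -sumrN; congr (_ + _).
apply: eq_bigr => i _.
by rewrite linearZ /= bar_htpy_gen bar_faceS_cons exprS mulN1r scaleNr.
Qed.

Lemma bar_exact0 (x : bar K S 0) : bar_aug x = 0 <-> exists y, bar_diff y = x.
Proof.
split=> [x0|[y <-]].
  exists (bar_htpy x); rewrite [LHS]bar_htpyP0 x0.
  by rewrite [bar_section _](@linear0 _ _ _ _ (lext _)) subr0.
apply: (@bar_linear_eq _ _ _ _ (bar_aug \o @bar_diff K S 0) \0) => [||t]; try exact: linearP.
have aug i : bar_aug (bar_gen K (bar_face i (bar_unit t))) =
    (gen (rs_idempotent (rs (tprod t))) : FE).
  rewrite [LHS]bar_aug_gen; congr gen; apply: val_inj.
  by rewrite [LHS]rs_bar_face.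
rewrite /= bar_diff_gen big_ord_recl big_ord1 scale1r scaleN1r linearB /=.
rewrite [X in X - _]aug [X in _ - X]aug.
exact: subrr.
Qed.

Lemma bar_exactS n (x : bar K S n.+1) :
  bar_diff x = 0 <-> exists y, bar_diff y = x.
Proof.
split=> [x0|[y <-]]; last exact: bar_diffK.
exists (bar_htpy x); rewrite [LHS]bar_htpyPS x0 [bar_htpy _]linear0.
exact: subr0.
Qed.

Definition bar_resolution : projective_resolution KE :=
  @ProjectiveResolution _ KE (bar K S) (@bar_diff K S) bar_aug
    (@bar_projective K S) (fun x => ex_intro _ (bar_section x) (bar_sectionK x))
    bar_exact0 bar_exactS.

End BarExactness.

Section BarUnitFaces.
Variables (S : inverseMonoidType) (n : nat) (t : n.+1.-tuple S).

Lemma nth_bar_index_face i (k : 'I_n) :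
  tnth (bar_index (bar_face i (bar_unit t))) k =
  merge_at i (nth 1%g (rs (tprod t) :: t)) k.+1.
Proof. by rewrite (tnth_nth 1%g) /= nth_behead nth_face // ltnS. Qed.

Lemma bar_index_face_first : bar_index (bar_face 0 (bar_unit t)) = tdrop_first t.
Proof.
apply: eq_from_tnth => k; rewrite nth_bar_index_face tnth_mktuple.
by rewrite (tnth_nth 1%g).
Qed.

Lemma bar_index_face_merge (i : 'I_n) :
  bar_index (bar_face i.+1 (bar_unit t)) = tmerge i t.
Proof.
apply: eq_from_tnth => k; rewrite nth_bar_index_face tnth_mktuple.
by rewrite !(tnth_nth 1%g) /merge_at ltnS eqSS.
Qed.

Lemma bar_index_face_last :
  bar_index (bar_face n.+1 (bar_unit t)) = tdrop_last t.
Proof.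
apply: eq_from_tnth => k; rewrite nth_bar_index_face tnth_mktuple.
by rewrite (tnth_nth 1%g) /merge_at ltnS ltn_ord.
Qed.

Lemma bar_head_face0 :
  nth 1%g (val (bar_face 0 (bar_unit t))) 0 = (rs (tprod t) * thead t)%g.
Proof. by rewrite [LHS]nth_face // /merge_at /thead (tnth_nth 1%g). Qed.

Lemma bar_head_faceS i :
  nth 1%g (val (bar_face i.+1 (bar_unit t))) 0 = rs (tprod t).
Proof. by rewrite [LHS]nth_face. Qed.

End BarUnitFaces.

(** * Cochains as homomorphisms *)

Section CochainIsomorphism.
Variables (K : comPzRingType) (S : inverseMonoidType).
Local Notation KS := (semigroup_algebra K S).
Variable V : lmodType KS.

Definition cochain_fun n : cochains V n -> n.-tuple S -> V :=
  match n with 0 => fun x _ => x | m.+1 => fun f => val f end.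

Lemma cochain_fun_rV n (f : cochains V n) t : in_rV (tprod t) (cochain_fun f t).
Proof.
case: n f t => [|n] f t; last by have /asboolP := valP f; exact.
by exists f; rewrite /tprod big_ord0 /rs invg1 mulg1 scale1r.
Qed.

Lemma cochain_funP n k (f g : cochains V n) t :
  cochain_fun (k *: f + g) t =
  k *: (cochain_fun f t : underK V) + (cochain_fun g t : underK V).
Proof. by case: n f g t. Qed.

Lemma cochain_fun_inj n (f g : cochains V n) :
  cochain_fun f =1 cochain_fun g -> f = g.
Proof.
case: n f g => [|n] f g fg; first exact: (fg [tuple]).
by apply: val_inj; apply/funext.
Qed.

Lemma cochain_fun_delta n (f : cochains V n) (t : n.+1.-tuple S) :
  cochain_fun (delta V n f) t = deltaS_fun (cochain_fun f) t.
Proof.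
case: n f t => [|n] f t //=.
rewrite /delta0_fun /deltaS_fun big_ord0 addr0 expr1 scaleN1r.
by rewrite /tprod big_ord1.
Qed.

Lemma delta_bar_lift n (a : n.-tuple S -> V) (t : n.+1.-tuple S) :
  (forall u, in_rV (tprod u) (a u)) ->
  bar_lift a (bar_diff (bar_gen K (bar_unit t))) = deltaS_fun a t.
Proof.
move=> ar; have arE s v := proj1 (@in_rVP _ _ V s v).
rewrite bar_diff_gen linear_sum big_ord_recl big_ord_recr addrA.
have lift_signed i c : bar_lift a ((-1) ^+ i *: bar_gen K c) =
    (-1) ^+ i *: (sgen K (nth 1%g (val c) 0) *: a (bar_index c)).
  by rewrite linearZ; congr (_ *: _); exact: bar_lift_gen.
congr (_ + _ + _).
- rewrite [LHS]lift_signed bar_head_face0 bar_index_face_first scale1r.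
  rewrite -sgenM -scalerA arE //.
  by rewrite -tprod_drop_first; exact: in_rVM.
- apply: eq_bigr => i _; rewrite [LHS]lift_signed bar_head_faceS.
  by rewrite bar_index_face_merge arE // -(tprod_merge i).
by rewrite [LHS]lift_signed bar_head_faceS bar_index_face_last.
Qed.

Fact cochain_hom_subproof n (f : cochains V n) :
  bar_lift (cochain_fun f) \in submodule_pred (hom_submodule (bar K S n) V).
Proof. by apply/asboolP; exact: linearP. Qed.

Definition cochain_hom n (f : cochains V n) : Defs.Hom (bar K S n) V :=
  to_submod (cochain_hom_subproof f).

Lemma hom_bar_eq n (f g : Defs.Hom (bar K S n) V) :
  (forall t, val f (bar_gen K (bar_unit t)) = val g (bar_gen K (bar_unit t))) ->
  f = g.
Proof.
move=> fg; apply: val_inj; apply/funext.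
have /asboolP lf := valP f; have /asboolP lg := valP g.
exact: (@bar_linear_eq _ _ _ _ (val f) (val g)).
Qed.

Lemma cochain_hom_unit n (f : cochains V n) t :
  val (cochain_hom f) (bar_gen K (bar_unit t)) = cochain_fun f t.
Proof.
rewrite [LHS]bar_lift_unit.
exact: (proj1 (in_rVP _ _) (cochain_fun_rV f t)).
Qed.

Lemma val_homP (P : lmodType KS) k (f g : Defs.Hom P V) x :
  val (k *: f + g) x = k *: (val f x : underK V) + (val g x : underK V).
Proof. exact: (congr1 (fun h : P -> underK V => h x) (linearP val k f g)). Qed.

Fact cochain_hom_linear n : linear (@cochain_hom n).
Proof.
move=> k f g; apply: hom_bar_eq => t.
rewrite [LHS]cochain_hom_unit cochain_funP.
by rewrite [RHS]val_homP (cochain_hom_unit f) (cochain_hom_unit g).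
Qed.

HB.instance Definition _ n :=
  GRing.isLinear.Build K (cochains V n) (Defs.Hom (bar K S n) V) _
    (@cochain_hom n) (@cochain_hom_linear n).

Lemma hom_unit_rV n (f : Defs.Hom (bar K S n) V) t :
  in_rV (tprod t) (val f (bar_gen K (bar_unit t)) : V).
Proof.
have /asboolP lf := valP f.
apply/in_rVP; rewrite -(GRing.scalable_linear lf).
by rewrite (proj1 (in_rVP _ _) (bar_gen_unit_rV K t)).
Qed.

Fact hom_cochain_subproof n (f : Defs.Hom (bar K S n) V) :
  (fun t => val f (bar_gen K (bar_unit t))) \in submodule_pred (poscochains V n).
Proof. by apply/asboolP => t; exact: hom_unit_rV. Qed.

Definition hom_cochain n : Defs.Hom (bar K S n) V -> cochains V n :=
  match n with
  | 0 => fun f => val f (bar_gen K (bar_unit [tuple]))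
  | m.+1 => fun f => to_submod (hom_cochain_subproof f)
  end.

Lemma cochain_fun_hom n (f : Defs.Hom (bar K S n) V) t :
  cochain_fun (hom_cochain f) t = val f (bar_gen K (bar_unit t)).
Proof.
case: n f t => [|n] f t; last exact: erefl.
by rewrite [t]tuple0.
Qed.

Lemma cochain_homK n : cancel (@cochain_hom n) (@hom_cochain n).
Proof.
move=> f; apply: cochain_fun_inj => t.
by rewrite cochain_fun_hom cochain_hom_unit.
Qed.

Lemma hom_cochainK n : cancel (@hom_cochain n) (@cochain_hom n).
Proof.
by move=> f; apply: hom_bar_eq => t; rewrite cochain_hom_unit cochain_fun_hom.
Qed.

Fact hom_cochain_linear n : linear (@hom_cochain n).
Proof.
move=> k f g; apply: (can_inj (@cochain_homK n)).
by rewrite hom_cochainK linearP /= !hom_cochainK.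
Qed.

HB.instance Definition _ n :=
  GRing.isLinear.Build K (Defs.Hom (bar K S n) V) (cochains V n) _
    (@hom_cochain n) (@hom_cochain_linear n).

Lemma cochain_hom_delta n (f : cochains V n) :
  cochain_hom (delta V n f) = precomp (@bar_diff K S n) (cochain_hom f).
Proof.
apply: hom_bar_eq => t; rewrite cochain_hom_unit cochain_fun_delta.
by rewrite [RHS]delta_bar_lift // => u; exact: cochain_fun_rV.
Qed.

Lemma deltaK n (f : cochains V n) : delta V n.+1 (delta V n f) = 0.
Proof.
apply: (can_inj (@cochain_homK n.+2)).
rewrite !cochain_hom_delta linear0.
exact: (@hom_complexK _ _ _ V (bar_resolution K S) n).
Qed.

Lemma cohomology_cochains_isomorphic n :
  isomorphic (cohomology (CochainComplex deltaK) n) (Ext V (bar_resolution K S) n).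
Proof.
have coboundary0 (R : pzRingType) (C : cochain_complex R) m :
    @is_coboundary R C m 0.
  by case: m => // m; exists 0; rewrite linear0.
apply: (@cohomology_isomorphic _ (CochainComplex deltaK)
  (hom_complex V (bar_resolution K S)) (fun n => @cochain_hom n)
  (fun n => @hom_cochain n)) => {n} n f.
- exact: cochain_hom_delta.
- apply: (can_inj (@cochain_homK _)).
  by rewrite hom_cochainK cochain_hom_delta hom_cochainK.
- rewrite /= cochain_homK subrr => _; exact: coboundary0.
- rewrite /= hom_cochainK subrr => _; exact: coboundary0.
Qed.

End CochainIsomorphism.

Theorem proposition3p8 (K : comPzRingType) (S : inverseMonoidType)
    (V : lmodType (semigroup_algebra K S)) :
  exists dd : forall (n : nat) (x : cochains V n),
      delta V n.+1 (delta V n x) = 0,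
  forall (P : projective_resolution (idem_module K S)) (n : nat),
    isomorphic (cohomology (CochainComplex dd) n) (Ext V P n).
Proof.
exists (@deltaK K S V) => P n.
apply: isomorphic_trans (cohomology_cochains_isomorphic V n) _.
exact: Ext_isomorphic.
Qed.
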